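(* Let $\lambda\in[0,1]$ and $T\in\mathbb{M}_{n}(\mathbb{C})$. Then $$\omega(\Delta(T))\le\frac12\,\omega\big(P_{\lambda}(T)+P_{1-\lambda}(T)\big)\le\frac12\,\omega(P_{\lambda}(T))+\frac12\,\omega(P_{1-\lambda}(T)).$$ In particular, setting $\lambda=0$ or $\lambda=1$ gives $\omega(\Delta(T))\le\frac12\omega(T)+\frac12\omega(T^{D})$.
   Context: $\mathbb{M}_{n}(\mathbb{C})$ is the set of $n\times n$ complex matrices, acting on $\mathbb{C}^n$ with the standard inner product. The numerical radius is $\omega(S)=\sup\{|\langle Sx,x\rangle|:\|x\|=1\}$. Every $T$ has a unique polar decomposition $T=U|T|$, where $|T|=(T^{*}T)^{1/2}$ and $U$ is a partial isometry with $\mathcal{N}(U)=\mathcal{N}(T)$. The Duggal transform is $T^{D}=|T|U$, the Aluthge transform is $\Delta(T)=|T|^{1/2}U|T|^{1/2}$, and for $\lambda\in[0,1]$ the power mean transform is $P_{\lambda}(T)=(1-\lambda)^2T+\lambda^2T^{D}+2\lambda(1-\lambda)\Delta(T)$. *)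

(* Defs.v *)
From HB Require Import structures.
From mathcomp Require Import all_boot all_order all_algebra.
From mathcomp Require Import complex.
From mathcomp Require Import boolp classical_sets reals.

Set Implicit Arguments.
Unset Strict Implicit.
Unset Printing Implicit Defensive.

Import Order.TTheory GRing.Theory Num.Theory.

Local Open Scope ring_scope.
Local Open Scope complex_scope.
Local Open Scope classical_set_scope.
Local Open Scope sesquilinear_scope.

Section Operators.
Variables (C : numClosedFieldType) (n : nat).

(* [dotmx] is the library's inner product of row vectors, linear in its first
   argument and conjugate-linear in the second. *)
Definition inner (x y : 'cV[C]_n) : C := dotmx x^T y^T.

Definition vnorm (x : 'cV[C]_n) : C := sqrtC (inner x x).

Definition psdmx (A : 'M[C]_n) : Prop :=
  A \is hermsymmx /\ forall x, 0 <= inner (A *m x) x.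

(* The positive semidefinite square root, meaningful for [psdmx A]; see
   [sqrtmxP] and [psdmx_sqr_inj]. *)
Definition sqrtmx (A : 'M[C]_n) : 'M[C]_n :=
  xget 0 [set B | psdmx B /\ B *m B = A].

Definition absmx (T : 'M[C]_n) : 'M[C]_n := sqrtmx (T^t* *m T).

(* [U] is isometric on the orthogonal complement of its null space. *)
Definition partial_isometry (U : 'M[C]_n) : Prop :=
  forall x, (forall y, U *m y = 0 -> inner x y = 0) -> vnorm (U *m x) = vnorm x.

Definition polar_factor (T U : 'M[C]_n) : Prop :=
  [/\ T = U *m absmx T, partial_isometry U
    & forall x : 'cV[C]_n, U *m x = 0 <-> T *m x = 0].

(* Existence and uniqueness: [polarmxP] and [polar_factor_uniq]. *)
Definition polarmx (T : 'M[C]_n) : 'M[C]_n := xget 0 [set U | polar_factor T U].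

Definition duggal (T : 'M[C]_n) : 'M[C]_n := absmx T *m polarmx T.

Definition aluthge (T : 'M[C]_n) : 'M[C]_n :=
  sqrtmx (absmx T) *m polarmx T *m sqrtmx (absmx T).

Lemma innerE x y : inner x y = (y^t* *m x) 0 0.
Proof.
rewrite /inner dotmxE trmxK !mxE; apply: eq_bigr => k _.
by rewrite !mxE mulrC.
Qed.

Lemma inner_adj (A : 'M[C]_n) x y : inner (A *m x) y = inner x (A^t* *m y).
Proof. by rewrite !innerE trmx_mul map_mxM trmxCK mulmxA. Qed.

Lemma inner_ge0 x : 0 <= inner x x.
Proof. exact: dnorm_ge0. Qed.

Lemma inner_eq0 x : (inner x x == 0) = (x == 0).
Proof. by rewrite /inner dnorm_eq0 trmx_eq0. Qed.

Lemma hermE (A : 'M[C]_n) : reflect (A^t* = A) (A \is hermsymmx).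
Proof.
by apply: (iffP (is_hermitianmxP _ _ _)); rewrite expr0 scale1r => h.
Qed.

Lemma gram_eq0 (A : 'M[C]_n) : A^t* *m A = 0 -> A = 0.
Proof.
move=> A0; apply/matrixP => i j.
suff /eqP /matrixP/(_ i 0) : A *m delta_mx j 0 == 0 :> 'cV_n.
  by rewrite -colE !mxE.
by rewrite -inner_eq0 inner_adj mulmxA A0 mul0mx innerE trmx0 map_mx0 mul0mx mxE.
Qed.

Lemma gram_psd (T : 'M[C]_n) : psdmx (T^t* *m T).
Proof.
split; first by apply/hermE; rewrite trmx_mul map_mxM trmxCK.
by move=> x; rewrite -mulmxA inner_adj trmxCK inner_ge0.
Qed.

Lemma psd_diag (A : 'M[C]_n) : psdmx A ->
  exists P : 'M[C]_n, exists d : 'rV[C]_n,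
  [/\ P *m P^t* = 1%:M, P^t* *m P = 1%:M, forall i, 0 <= d 0 i
    & A = P^t* *m diag_mx d *m P].
Proof.
case=> hA pA; have := orthomx_spectralP (hermitian_normalmx hA).
set P := spectralmx A; set d := spectral_diag A => eA.
have uP : P \is unitarymx by exact: spectral_unitarymx.
rewrite invmx_unitary // in eA.
have PPt := unitarymxP uP; have PtP := mulmx1C PPt.
exists P, d; split=> // i.
have := pA (P^t* *m delta_mx i 0).
rewrite {1}eA -!mulmxA (mulmxA P) PPt mul1mx inner_adj trmxCK mulmxA PPt mul1mx.
rewrite innerE mul_diag_mx mxE (bigD1 i) //= big1 => [|k ki].
  by rewrite !mxE !eqxx /= conjC1 mul1r mulr1 addr0.
by rewrite !mxE (negPf ki) /= conjC0 mul0r.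
Qed.

Lemma diag_psd (P : 'M[C]_n) (d : 'rV[C]_n) : (forall i, 0 <= d 0 i) ->
  psdmx (P^t* *m diag_mx d *m P).
Proof.
move=> d0.
pose s : 'rV[C]_n := \row_i sqrtC (d 0 i).
have -> : P^t* *m diag_mx d *m P = (diag_mx s *m P)^t* *m (diag_mx s *m P).
  rewrite trmx_mul map_mxM tr_diag_mx map_diag_mx !mulmxA.
  rewrite -[P^t* *m _ *m diag_mx s]mulmxA mulmx_diag.
  congr (_ *m diag_mx _ *m _); apply/rowP => i; rewrite !mxE /=.
  by rewrite geC0_conj ?sqrtC_ge0 // -expr2 sqrtCK.
exact: gram_psd.
Qed.

Lemma psdmx_sqr_inj (A B : 'M[C]_n) : psdmx A -> psdmx B ->
  A *m A = B *m B -> A = B.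
Proof.
move=> /psd_diag[P [a [PPt PtP a0 ->]]] /psd_diag[Q [b [QQt QtQ b0 ->]]].
set DA := diag_mx a; set DB := diag_mx b => e.
have e2 : DA *m DA *m (P *m Q^t*) = P *m Q^t* *m (DB *m DB).
  have := congr1 (fun X => P *m X *m Q^t*) e.
  rewrite !mulmxA PPt mul1mx -[_ *m P *m P^t*]mulmxA PPt mulmx1.
  by rewrite -[_ *m Q *m Q^t*]mulmxA QQt mulmx1 -[_ *m Q *m Q^t*]mulmxA QQt mulmx1.
have e1 : DA *m (P *m Q^t*) = P *m Q^t* *m DB.
  apply/matrixP => i j; rewrite mul_diag_mx mul_mx_diag !mxE.
  move/matrixP/(_ i j): e2; rewrite !mulmx_diag mul_diag_mx mul_mx_diag !mxE.
  set w := \sum__ _; have [->|w0] := eqVneq w 0; first by rewrite !mulr0 !mul0r.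
  rewrite [w * _]mulrC => /(mulIf w0) /eqP.
  by rewrite -!expr2 eqrXn2 // => /eqP ->; rewrite mulrC.
have := congr1 (fun X => P^t* *m X *m Q) e1.
by rewrite !mulmxA PtP mul1mx -!mulmxA QtQ mulmx1 !mulmxA.
Qed.

Lemma sqrtmxP (A : 'M[C]_n) : psdmx A ->
  psdmx (sqrtmx A) /\ sqrtmx A *m sqrtmx A = A.
Proof.
move=> /psd_diag[P [a [PPt PtP a0 eA]]].
apply: (@xgetPex _ 0 [set B | psdmx B /\ B *m B = A]).
exists (P^t* *m diag_mx (\row_i sqrtC (a 0 i)) *m P); split.
  by apply: diag_psd => i; rewrite mxE sqrtC_ge0.
rewrite !mulmxA -[_ *m P *m P^t*]mulmxA PPt mulmx1 -[P^t* *m _ *m _]mulmxA.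
rewrite mulmx_diag eA; congr (_ *m diag_mx _ *m _); apply/rowP => i.
by rewrite !mxE -expr2 sqrtCK.
Qed.

Lemma absmxP (T : 'M[C]_n) :
  psdmx (absmx T) /\ absmx T *m absmx T = T^t* *m T.
Proof. exact/sqrtmxP/gram_psd. Qed.

Lemma psd_pinv (A : 'M[C]_n) : psdmx A -> exists G : 'M[C]_n,
  [/\ G^t* = G, A *m G = G *m A, A *m G *m A = A & G *m A *m G = G].
Proof.
move=> /psd_diag[P [a [PPt PtP a0 ->]]].
pose b : 'rV[C]_n := \row_i (a 0 i)^-1.
have mulD (D E : 'M[C]_n) :
    (P^t* *m D *m P) *m (P^t* *m E *m P) = P^t* *m (D *m E) *m P.
  by rewrite !mulmxA -[_ *m P *m P^t*]mulmxA PPt mulmx1.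
exists (P^t* *m diag_mx b *m P); split.
- rewrite !trmx_mul !map_mxM trmxCK tr_diag_mx map_diag_mx mulmxA.
  congr (_ *m diag_mx _ *m _); apply/rowP => i; rewrite !mxE /=.
  by rewrite geC0_conj // invr_ge0.
- by rewrite !mulD diag_mxC.
- rewrite !mulD !mulmx_diag; congr (_ *m diag_mx _ *m _).
  apply/rowP => i; rewrite !mxE; have [->|h] := eqVneq (a 0 i) 0.
    by rewrite mulr0.
  by rewrite divff // mul1r.
- rewrite !mulD !mulmx_diag; congr (_ *m diag_mx _ *m _).
  apply/rowP => i; rewrite !mxE; have [->|h] := eqVneq (a 0 i) 0.
    by rewrite invr0 mulr0.
  by rewrite mulVf // mul1r.
Qed.

Lemma absmx_ker (T : 'M[C]_n) (x : 'cV[C]_n) : absmx T *m x = 0 <-> T *m x = 0.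
Proof.
have [[/hermE hA _] sA] := absmxP T.
have e : inner (absmx T *m x) (absmx T *m x) = inner (T *m x) (T *m x).
  by rewrite inner_adj hA mulmxA sA [RHS]inner_adj mulmxA.
by split=> /eqP h; apply/eqP; move: h; rewrite -!inner_eq0 e.
Qed.

Lemma polar_factor_uniq (T U V : 'M[C]_n) :
  polar_factor T U -> polar_factor T V -> U = V.
Proof.
have [G [hG cG AGA GAG]] := psd_pinv (absmxP T).1.
suff H W : polar_factor T W -> W = T *m G by move=> /H -> /H ->.
case=> eW _ kW; rewrite {1}eW -mulmxA; apply/eqP; rewrite -subr_eq0.
rewrite -{1}[W]mulmx1 -mulmxBr; apply/eqP/matrixP => i j.
suff /matrixP/(_ i 0) : W *m (1%:M - absmx T *m G) *m delta_mx j 0 = 0 :> 'cV_n.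
  by rewrite -colE !mxE.
rewrite -mulmxA; apply/kW/absmx_ker.
by rewrite mulmxA mulmxBr mulmx1 cG mulmxA AGA subrr mul0mx.
Qed.

Lemma polarmxP (T : 'M[C]_n) : polar_factor T (polarmx T).
Proof.
apply: (@xgetPex _ 0 [set U | polar_factor T U]).
have [[/hermE hA _] sA] := absmxP T.
have [G [hG cG AGA GAG]] := psd_pinv (absmxP T).1.
set A := absmx T in hA sA cG AGA GAG *; pose E := A *m G.
have hE : E^t* = E by rewrite trmx_mul map_mxM hA hG -cG.
have TE : T *m E = T.
  apply/eqP; rewrite -subr_eq0 -{2}[T]mulmx1 -mulmxBr; apply/eqP/gram_eq0.
  rewrite trmx_mul map_mxM mulmxA -[_ *m T^t* *m T]mulmxA -sA -!mulmxA.
  by rewrite mulmxBr mulmx1 /E cG [A *m (_ *m _)]mulmxA AGA subrr !mulmx0.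
have UU : (T *m G)^t* *m (T *m G) = E.
  rewrite trmx_mul map_mxM hG mulmxA -[_ *m T^t* *m T]mulmxA -sA !mulmxA.
  by rewrite -cG AGA.
have GE : G *m E = G by rewrite /E mulmxA GAG.
have UE : T *m G *m E = T *m G by rewrite -mulmxA GE.
exists (T *m G); split.
- by rewrite -mulmxA -/A -cG TE.
- move=> x hx; congr sqrtC; rewrite inner_adj mulmxA UU.
  have : inner x ((1%:M - E) *m x) = 0.
    by apply: hx; rewrite mulmxA mulmxBr mulmx1 UE subrr mul0mx.
  rewrite mulmxBl mul1mx !innerE linearB /= map_mxB mulmxBl !mxE.
  by move/eqP; rewrite subr_eq0 => /eqP ->.
- move=> x; split=> h.
    by rewrite -TE -mulmxA -UU -[_ *m _ *m x]mulmxA h !mulmx0.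
  have Ax : A *m x = 0 by exact/absmx_ker.
  by rewrite -UE /E cG -!mulmxA Ax !mulmx0.
Qed.

End Operators.

Section NumericalRadius.
Variables (R : realType) (n : nat).

(* [normc] is the modulus as an element of [R]; [`|z|] lives in [R[i]]. *)
Definition numerical_radius (S : 'M[R[i]]_n) : R :=
  sup [set Normc.normc (inner (S *m x) x) | x in [set x | vnorm x = 1]].

Definition power_mean (lam : R) (T : 'M[R[i]]_n) : 'M[R[i]]_n :=
  ((1 - lam) ^+ 2)%:C *: T + (lam ^+ 2)%:C *: duggal T
  + (2 * lam * (1 - lam))%:C *: aluthge T.

End NumericalRadius.

(* Main.v *)
(** The key inequality is [w(B X B) <= w(X B^2 + B^2 X) / 2] for Hermitian [B].
    After rotating [X], it suffices to bound the top eigenvalue [mu] of [B H B],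
    [H] being twice the real part of [X]; if [B H B v = mu v], then
    [x = H B v] satisfies [H B^2 x = mu x], so that
    [<(H B^2 + B^2 H) x, x> = 2 mu |x|^2].
    Applied twice with [B = |T|^(1/4)], this gives
    [4 w(D) <= w(T + T^D + 2 D)] for the Aluthge transform [D]. Finally, with
    [c = (1-lam)^2 + lam^2], the sum of the two power means is
    [c (T + T^D + 2 D) - 2 (2c - 1) D], and [2c - 1 = (1 - 2 lam)^2 >= 0], so the
    triangle inequality concludes. *)

Require Import Defs.
From mathcomp Require Import all_boot all_order all_algebra.
From mathcomp Require Import reals complex.
From mathcomp Require Import boolp classical_sets ring lra.
Import Order.TTheory GRing.Theory Num.Theory.
Local Open Scope ring_scope.
Local Open Scope complex_scope.
Local Open Scope sesquilinear_scope.

(** * Hermitian forms on ['cV[C]_n]: eigenvalue bounds and the sandwich inequality *)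

Section Inner.
Context {C : numClosedFieldType} {n : nat}.
Implicit Types (A B X M S : 'M[C]_n) (x y : 'cV[C]_n) (r : C).

Lemma innerDl x y z : inner (x + y) z = inner x z + inner y z.
Proof. by rewrite !innerE mulmxDr mxE. Qed.

Lemma innerZl a x y : inner (a *: x) y = a * inner x y.
Proof. by rewrite !innerE -scalemxAr mxE. Qed.

Lemma vnorm_eq1 x : vnorm x = 1 -> inner x x = 1.
Proof. by move=> x1; rewrite -[LHS]sqrtCK -/(vnorm x) x1 expr1n. Qed.

Lemma inner_conj x y : inner y x = Num.conj (inner x y).
Proof.
rewrite !innerE !mxE rmorph_sum; apply: eq_bigr => k _.
by rewrite !mxE rmorphM /= conjCK mulrC.
Qed.

Lemma innerZr a x y : inner x (a *: y) = Num.conj a * inner x y.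
Proof. by rewrite inner_conj innerZl rmorphM /= -inner_conj. Qed.

Lemma inner_sum x : inner x x = \sum_i `|x i 0| ^+ 2.
Proof.
rewrite innerE mxE; apply: eq_bigr => k _.
by rewrite !mxE normCKC.
Qed.

(** In an orthonormal eigenbasis the Rayleigh quotient of [x] is a weighted average of the
    eigenvalues, so they cannot all lie strictly below it. *)
Lemma hermitian_eigen_ge_rayleigh M x : M^t* = M -> x != 0 ->
  exists (mu : C) (v : 'cV[C]_n),
  [/\ v != 0, M *m v = mu *: v & inner (M *m x) x <= mu * inner x x].
Proof.
move=> hM x0; have hA : M \is hermsymmx by apply/hermE.
have := orthomx_spectralP (hermitian_normalmx hA).
have dR := hermitian_spectral_diag_real hA.
set P := spectralmx M in dR *; set d := spectral_diag M in dR * => eM.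
have uP : P \is unitarymx by exact: spectral_unitarymx.
rewrite invmx_unitary // in eM.
have PPt := unitarymxP uP; have PtP := mulmx1C PPt.
pose y := P *m x.
have yx : inner y y = inner x x by rewrite inner_adj mulmxA PtP mul1mx.
have Mx : inner (M *m x) x = \sum_i d 0 i * `|y i 0| ^+ 2.
  rewrite {1}eM -!mulmxA inner_adj trmxCK -/y innerE mxE.
  by apply: eq_bigr => k _; rewrite mul_diag_mx !mxE normCKC mulrCA.
have [i ge_i] : exists i, inner (M *m x) x <= d 0 i * inner x x.
  apply/existsP; apply: contraT => /existsPn lt_i.
  (* The order on [C] is partial: a failed [<=] reverses to [<] only between real elements. *)
  have sR : inner (M *m x) x \is Num.real.
    rewrite Mx; apply: rpred_sum => k _.
    by rewrite rpredM ?rpredX ?normr_real ?(mxOverP dR).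
  have xx : 0 < inner x x by rewrite lt_def inner_eq0 x0 inner_ge0.
  have lt_i' k : d 0 k * inner x x < inner (M *m x) x.
    rewrite real_ltNge ?lt_i ?rpredM ?(mxOverP dR) //.
    exact: ger0_real (inner_ge0 x).
  (* Nonnegative terms with positive weights sum to zero, which forces every coordinate of [y] to
     vanish. *)
  have s0 : \sum_k (inner (M *m x) x - d 0 k * inner x x) * `|y k 0| ^+ 2 = 0.
    under eq_bigr do rewrite mulrBl mulrAC.
    by rewrite sumrB -mulr_suml -mulr_sumr -Mx -inner_sum yx mulrC subrr.
  have t0 k : 0 <= (inner (M *m x) x - d 0 k * inner x x) * `|y k 0| ^+ 2.
    by rewrite mulr_ge0 ?exprn_ge0 // subr_ge0 ltW.
  case/negP: x0; rewrite -inner_eq0 -yx inner_sum; apply/eqP.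
  apply: big1 => k _.
  have /eqP := psumr_eq0P (fun k _ => t0 k) s0 (erefl (xpredT k)).
  by rewrite mulf_eq0 subr_eq0 gt_eqF //= => /eqP.
exists (d 0 i), (P^t* *m delta_mx i 0); split=> //.
  apply/eqP => /(congr1 (mulmx P)).
  rewrite mulmxA PPt mul1mx mulmx0 => /matrixP/(_ i 0) /eqP.
  by rewrite !mxE !eqxx oner_eq0.
rewrite {1}eM mulmxA -(mulmxA _ P) PPt mulmx1 -mulmxA scalemxAr.
congr (_ *m _); apply/matrixP => k l; rewrite mul_diag_mx !mxE.
by case: eqP => [->|]; rewrite ?mulr0.
Qed.

(* The numerical radius of [S] is the least [r >= 0] with [form_le r S]. *)
Definition form_le (r : C) (S : 'M[C]_n) :=
  forall x, `|inner (S *m x) x| <= r * inner x x.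

Lemma form_le_sandwich B X r : 0 <= r -> B^t* = B ->
  form_le (2 * r) (X *m (B *m B) + B *m B *m X) -> form_le r (B *m X *m B).
Proof.
move=> r0 hB hY x; have [->|x0] := eqVneq x 0.
  by rewrite mulmx0 !innerE !mulmx0 !mxE normr0 mulr0.
set z := inner _ x.
(* The phase rotating [z] onto [|z|]; the value 1 at [z = 0] keeps [e] unimodular. *)
pose e : C := if z == 0 then 1 else Num.conj z / `|z|.
have e1 : `|e| = 1.
  rewrite /e; case: eqP => [_|/eqP z0]; first exact: normr1.
  by rewrite normrM norm_conjC normfV normr_id divff // normr_eq0.
have ez : e * z = `|z|.
  rewrite /e; case: eqP => [->|/eqP z0]; first by rewrite normr0 mulr0.
  by rewrite mulrAC -normCKC expr2 mulfK // normr_eq0.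
have form_re (S : 'M[C]_n) w : inner ((e *: S + (e *: S)^t*) *m w) w =
    e * inner (S *m w) w + Num.conj (e * inner (S *m w) w).
  rewrite mulmxDl innerDl -scalemxAl innerZl; congr (_ + _).
  by rewrite inner_adj trmxCK inner_conj -scalemxAl innerZl.
pose H := e *: X + (e *: X)^t*.
have hH : H^t* = H by rewrite linearD /= map_mxD trmxCK addrC.
have eBHB : B *m H *m B = e *: (B *m X *m B) + (e *: (B *m X *m B))^t*.
  rewrite /H mulmxDr mulmxDl -scalemxAr -scalemxAl; congr (_ + _).
  by rewrite scalemxAl scalemxAr !trmx_mul !map_mxM hB mulmxA.
have eHBB : H *m (B *m B) + B *m B *m H =
    e *: (X *m (B *m B) + B *m B *m X)
    + (e *: (X *m (B *m B) + B *m B *m X))^t*.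
  rewrite scalerDr [e *: (X *m _)]scalemxAl [e *: (_ *m X)]scalemxAr.
  rewrite [(_ + _)^T]linearD /= map_mxD !trmx_mul !map_mxM hB.
  rewrite /H mulmxDr mulmxDl addrACA; congr (_ + _).
  exact: addrC.
have hM : (B *m H *m B)^t* = B *m H *m B.
  by rewrite !trmx_mul !map_mxM hB hH mulmxA.
have [mu [v [v0 Mv]]] := hermitian_eigen_ge_rayleigh _ _ hM x0.
rewrite {1}eBHB form_re ez conj_normC => hx.
have xx : 0 < inner x x by rewrite lt_def inner_eq0 x0 inner_ge0.
have mu0 : 0 <= mu by rewrite -(pmulr_lge0 _ xx) (le_trans _ hx) ?addr_ge0.
(* [H] is twice a real part, so [hx] bounds [2 |z|] by [mu * inner x x]. *)
suff mur : mu <= 2 * r.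
  rewrite -(ler_pM2l (ltr0n C 2)) mulr2n mulrDl mul1r.
  by rewrite (le_trans hx) // mulrA ler_wpM2r // ltW.
pose w := H *m (B *m v).
have Bw : B *m w = mu *: v by rewrite /w !mulmxA.
have [w0|w0] := eqVneq w 0.
  move: Bw; rewrite w0 mulmx0 => /esym/eqP; rewrite scaler_eq0 (negPf v0) orbF.
  by move=> /eqP ->; rewrite mulr_ge0.
have ww : 0 < inner w w by rewrite lt_def inner_eq0 w0 inner_ge0.
have HBBw : H *m (B *m B) *m w = mu *: w.
  by rewrite -!mulmxA Bw -!scalemxAr.
have := hY w; set s := inner _ w => hs.
(* [w] is an eigenvector of [H B^2]; the summand [B^2 H] is its adjoint and contributes the
   conjugate of [mu * inner w w], which is the same real number. *)
have es : mu * inner w w + mu * inner w w = e * s + Num.conj (e * s).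
  rewrite -form_re -eHBB mulmxDl innerDl HBBw innerZl; congr (_ + _).
  rewrite inner_adj !trmx_mul !map_mxM hB hH HBBw innerZr.
  by rewrite geC0_conj.
have [re_le _] := leif_Re_Creal (e * s).
move: re_le; rewrite ReE normrM e1 mul1r ler_pdivrMr ?ltr0n // => re_le.
rewrite -es -mulr2n -(mulr_natr (mu * _)) ler_pM2r ?ltr0n // in re_le.
by rewrite -(ler_pM2r ww) (le_trans re_le).
Qed.

(** A crude entrywise bound suffices: it serves to make the supremum defining the numerical radius
    finite. *)
Lemma form_le_bounded S : exists r, form_le r S.
Proof.
exists (\sum_i \sum_j `|S i j|) => x.
have le_x i : `|x i 0| ^+ 2 <= inner x x.
  rewrite inner_sum (bigD1 i) //= lerDl; apply: sumr_ge0 => k _.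
  exact: exprn_ge0.
have le_xx i j : `|x i 0| * `|x j 0| <= inner x x.
  rewrite -(@ler_pXn2r _ 2) ?nnegrE ?mulr_ge0 ?inner_ge0 //.
  by rewrite exprMn [leRHS]expr2 ler_pM ?exprn_ge0.
rewrite innerE mxE mulr_suml; apply: le_trans (ler_norm_sum _ _ _) _.
apply: ler_sum => i _; rewrite !mxE mulr_sumr mulr_suml.
apply: le_trans (ler_norm_sum _ _ _) _; apply: ler_sum => j _.
  by rewrite !normrM norm_conjC mulrCA ler_wpM2l.
Qed.

Lemma form_leD r1 r2 S1 S2 :
  form_le r1 S1 -> form_le r2 S2 -> form_le (r1 + r2) (S1 + S2).
Proof.
move=> h1 h2 x; rewrite mulmxDl innerDl mulrDl.
by rewrite (le_trans (ler_normD _ _)) // lerD.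
Qed.

Lemma form_leZ a r S : form_le r S -> form_le (`|a| * r) (a *: S).
Proof.
by move=> h x; rewrite -scalemxAl innerZl normrM -mulrA ler_wpM2l.
Qed.

(* Two rounds of the sandwich inequality, with [B = |T|^(1/4)] conjugating first
   [U|T|^(1/2) + |T|^(1/2)U] and then [BUB]. *)
Lemma form_le_aluthge T r : 0 <= r ->
  form_le (4 * r) (T + duggal T + 2 *: aluthge T) -> form_le r (aluthge T).
Proof.
move=> r0; have [pT AA] := absmxP T.
have [eT _ _] := polarmxP T.
rewrite /duggal /aluthge; set U := polarmx T in eT *.
have [pA eA] := sqrtmxP pT; set A := sqrtmx (absmx T) in pA eA *.
have [[/hermE hB _] eB] := sqrtmxP pA; set B := sqrtmx A in hB eB *.
rewrite {1}eT -eA => h.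
pose L := U *m A + A *m U.
have hL : form_le (2 * r) (B *m L *m B).
  apply: form_le_sandwich => //; first exact: mulr_ge0.
  rewrite mulrA -natrM.
  (* With [A^2 = |T|] and [B^2 = A], expanding [L A + A L] gives [T], the Duggal transform and twice
     the Aluthge transform. *)
  suff <- : U *m (A *m A) + A *m A *m U + 2 *: (A *m U *m A) =
    L *m (B *m B) + B *m B *m L by [].
  rewrite eB /L mulmxDl mulmxDr !mulmxA scaler_nat mulr2n addrACA.
  by congr (_ + _); apply: addrC.
have -> : A *m U *m A = B *m (B *m U *m B) *m B by rewrite -eB !mulmxA.
apply: form_le_sandwich => //.
suff <- : B *m L *m B =
  B *m U *m B *m (B *m B) + B *m B *m (B *m U *m B) by [].
by rewrite /L -eB mulmxDr mulmxDl !mulmxA.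
Qed.
End Inner.

(** * Numerical radius as a seminorm, and its values on power means *)

Section NumericalRadius.
Context {R : realType} {n : nat}.
Implicit Types (S : 'M[R[i]]_n) (r : R).

Let normcE (z : R[i]) : `|z| = (Normc.normc z)%:C. Proof. by []. Qed.

Lemma numerical_radius_ub S (x : 'cV[R[i]]_n) : vnorm x = 1 ->
  Normc.normc (inner (S *m x) x) <= numerical_radius S.
Proof.
move=> x1; apply: ub_le_sup; last by exists x.
have [r hr] := form_le_bounded S; exists (complex.Re r) => _ [y /= y1 <-].
have := hr y; rewrite (vnorm_eq1 _ y1).
by rewrite mulr1 normcE lecE => /andP[].
Qed.

Lemma numerical_radius_ge0 S : 0 <= numerical_radius S.
Proof.
rewrite /numerical_radius; set E := [set _ | _ in _]%classic.
(* For [n = 0] there is no unit vector, and the supremum of the empty set is 0 by convention. *)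
have [->|/set0P[_ [x x1 _]]] := eqVneq E set0; first by rewrite sup0.
by apply: le_trans (numerical_radius_ub S x x1); rewrite -ler0c -normcE.
Qed.

(** Both sides are homogeneous of degree two in [x], so normalizing [x] reduces to unit vectors. *)
Lemma form_le_numerical_radius S : form_le (numerical_radius S)%:C S.
Proof.
move=> x; have [->|x0] := eqVneq x 0.
  by rewrite mulmx0 !innerE !mulmx0 !mxE normr0 mulr0.
have xx : inner x x != 0 by rewrite inner_eq0.
pose c := (vnorm x)^-1.
have c0 : 0 <= c by rewrite invr_ge0 sqrtC_ge0 inner_ge0.
have c2 : c * c = (inner x x)^-1 by rewrite /c -invfM -expr2 sqrtCK.
have scale (y : 'cV_n) : inner (c *: y) (c *: x) = (inner x x)^-1 * inner y x.
  by rewrite innerZl innerZr geC0_conj // mulrA c2.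
have /(numerical_radius_ub S) : vnorm (c *: x) = 1.
  by rewrite /vnorm scale mulVf // sqrtC1.
rewrite -lecR -normcE -scalemxAr scale normrM ger0_norm ?invr_ge0 ?inner_ge0 //.
by rewrite ler_pdivrMl ?[_ * inner x x]mulrC // lt_def xx inner_ge0.
Qed.

Lemma numerical_radius_le S r : 0 <= r -> form_le r%:C S ->
  numerical_radius S <= r.
Proof.
move=> r0 h; rewrite /numerical_radius; set E := [set _ | _ in _]%classic.
(* In the empty case the supremum is 0, and [0 <= r] closes the goal. *)
have [->|/set0P E0] := eqVneq E set0; first by rewrite sup0.
apply: ge_sup => // _ [x /= x1 <-]; have := h x.
by rewrite (vnorm_eq1 _ x1) mulr1 normcE lecR.
Qed.

Lemma numerical_radiusD S1 S2 :
  numerical_radius (S1 + S2) <= numerical_radius S1 + numerical_radius S2.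
Proof.
apply: numerical_radius_le; first by rewrite addr_ge0 ?numerical_radius_ge0.
by rewrite rmorphD; apply: form_leD; apply: form_le_numerical_radius.
Qed.

Lemma numerical_radiusZ_le r S : 0 <= r ->
  numerical_radius (r%:C *: S) <= r * numerical_radius S.
Proof.
move=> r0; apply: numerical_radius_le; first by rewrite mulr_ge0 ?numerical_radius_ge0.
rewrite rmorphM /= -{1}[r%:C]ger0_norm ?ler0c //.
by apply: form_leZ; apply: form_le_numerical_radius.
Qed.

Lemma numerical_radius_aluthge_le (T : 'M[R[i]]_n) : 4 * numerical_radius (aluthge T)
  <= numerical_radius (T + duggal T + 2 *: aluthge T).
Proof.
rewrite -ler_pdivlMl //; set w := numerical_radius (_ + _).
have w0 : 0 <= 4^-1 * w by rewrite mulr_ge0 ?numerical_radius_ge0 ?invr_ge0.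
apply: numerical_radius_le => //; apply: form_le_aluthge; first by rewrite ler0c.
have -> : 4 * (4^-1 * w)%:C = w%:C.
  by rewrite -(rmorph_nat (real_complex R)) -rmorphM mulrA mulfV ?mul1r // pnatr_eq0.
exact: form_le_numerical_radius.
Qed.

Lemma power_mean0 (T : 'M[R[i]]_n) : power_mean 0 T = T.
Proof.
by rewrite /power_mean subr0 expr1n expr0n /= mulr0 mul0r scale1r !scale0r !addr0.
Qed.

Lemma power_mean1 (T : 'M[R[i]]_n) : power_mean 1 T = duggal T.
Proof.
by rewrite /power_mean subrr expr1n expr0n /= mulr0 scale1r !scale0r add0r addr0.
Qed.

Lemma numerical_radius_power_mean (lam : R) (T : 'M[R[i]]_n) :
  numerical_radius (aluthge T)
    <= 2^-1 * numerical_radius (power_mean lam T + power_mean (1 - lam) T).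
Proof.
set Y := _ + _; set w := numerical_radius (aluthge T).
pose c := (1 - lam) ^+ 2 + lam ^+ 2; pose d := 2 * (2 * c - 1).
have c0 : 0 < c by have := sqr_ge0 (1 - 2 * lam); rewrite /c !expr2; lra.
have d0 : 0 <= d.
  have -> : d = 2 * (1 - 2 * lam) ^+ 2 by rewrite /d /c; ring.
  by rewrite mulr_ge0 ?sqr_ge0.
(* The expansion of [Y] is solved for the left side, so that [aluthge T] enters with the nonnegative
   coefficient [d] and the triangle inequality applies. *)
have e : T + duggal T + 2 *: aluthge T =
    (c^-1)%:C *: (Y + d%:C *: aluthge T).
  have c0' : c%:C != 0 by rewrite (fmorph_eq0 (real_complex R)) gt_eqF.
  apply: (scalerI c0'); rewrite scalerA -rmorphM mulfV ?gt_eqF // scale1r.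
  rewrite /Y /power_mean /d /c; apply/matrixP => i j; rewrite !mxE.
  rewrite !(rmorphD, rmorphM, rmorphB, rmorphXn, rmorph1, rmorph_nat) /=.
  ring.
have := numerical_radius_aluthge_le T; rewrite e -/w => h.
have ci0 : 0 <= c^-1 by rewrite invr_ge0 ltW.
have := numerical_radiusZ_le c^-1 (Y + d%:C *: aluthge T) ci0.
move=> /(le_trans h); rewrite mulrC -ler_pdivrMl ?invr_gt0 // invrK mulrC.
move=> /le_trans/(_ (numerical_radiusD _ _)).
have := numerical_radiusZ_le d (aluthge T) d0; rewrite -/w /d.
(* The bounds combine to [4 c w <= y + d w]; since [d = 4 c - 2], this is [2 w <= y]. *)
set y := numerical_radius Y; set v := numerical_radius _; nra.
Qed.

End NumericalRadius.

Theorem theorem2p29 (R : realType) (n : nat) (T : 'M[R[i]]_n) :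
  (forall lam : R, 0 <= lam <= 1 ->
     numerical_radius (aluthge T)
       <= 2^-1 * numerical_radius (power_mean lam T + power_mean (1 - lam) T)
     /\ 2^-1 * numerical_radius (power_mean lam T + power_mean (1 - lam) T)
       <= 2^-1 * numerical_radius (power_mean lam T)
          + 2^-1 * numerical_radius (power_mean (1 - lam) T))
  /\ numerical_radius (aluthge T)
       <= 2^-1 * numerical_radius T + 2^-1 * numerical_radius (duggal T).
Proof.
have le2 S1 S2 : 2^-1 * numerical_radius (S1 + S2)
    <= 2^-1 * numerical_radius S1 + 2^-1 * numerical_radius S2 :> R.
  by rewrite -mulrDr ler_wpM2l ?invr_ge0 // numerical_radiusD.
split=> [lam _|]; first by split; [exact: numerical_radius_power_mean | exact: le2].
have := numerical_radius_power_mean 0 T.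
rewrite subr0 power_mean0 power_mean1 => /le_trans; apply; exact: le2.
Qed.
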